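(* Let $(x_n)_{n\ge1}$ be a sequence in $\mathbb{R}^d$ such that the sequence $\big(\frac1n\sum_{i=1}^n\|x_i\|^2\big)_{n=1}^\infty$ is bounded, and for each $n$ let $\hat{\mathcal J}(x_1,\ldots,x_n)$ be a MAP partition of $[n]$. Then for every $r>0$ the number of clusters that intersect the ball $B(\mathbf 0,r)$ is bounded, i.e. $$\limsup_{n\to\infty}\big|\{J\in\hat{\mathcal J}(x_1,\ldots,x_n) : \exists\, j\in J\ \|x_j\|<r\}\big|<\infty .$$
   Context: Fix $d\ge 1$, $\alpha>0$ and symmetric positive definite matrices $T,\Sigma\in\mathbb{R}^{d\times d}$. Put $C=\alpha/\sqrt{\det T}$, $R=\Sigma^{-1/2}$ and $R_m=(\Sigma^{-1}+T^{-1}/m)^{1/2}$ for $m\in\mathbb{N}$ (symmetric positive definite square roots); $\|\cdot\|$ is the Euclidean norm and $[n]=\{1,\ldots,n\}$. For $\mathbf{x}=(x_1,\ldots,x_n)\in(\mathbb{R}^d)^n$, nonempty $J\subseteq[n]$, let $\overline{\mathbf{x}_J}=\frac1{|J|}\sum_{j\in J}x_j$. For a partition $\mathcal J$ of $[n]$ into nonempty sets (clusters) let $$Q_{\mathbf{x}}(\mathcal J)=C^{|\mathcal J|}\prod_{J\in\mathcal J}\frac{|J|!}{|J|^{(d+2)/2}\det R_{|J|}}\cdot\exp\Big\{\frac12\sum_{J\in\mathcal J}|J|\cdot\big\|R_{|J|}^{-1}R^2\,\overline{\mathbf{x}_J}\big\|^2\Big\}.$$ Up to a factor not depending on $\mathcal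 J$, this is the posterior probability of $\mathcal J$ given $\mathbf{x}$ in the Gaussian mixture model in which $\mathcal J$ follows the Chinese Restaurant Process with parameter $\alpha$, cluster means are i.i.d. $\mathcal N(0,T)$, and given its cluster mean $\theta$ each observation of a cluster is independently $\mathcal N(\theta,\Sigma)$. A MAP (maximal a posteriori) partition $\hat{\mathcal J}(x_1,\ldots,x_n)$ is any partition of $[n]$ maximising $Q_{\mathbf{x}}$. $B(\mathbf 0,r)$ is the ball of radius $r$ centred at the origin. *)

(* Defs.v *)
From HB Require Import structures.
From mathcomp Require Import all_boot all_order all_algebra.
From mathcomp Require Import all_classical all_reals all_analysis.

Set Implicit Arguments.
Unset Strict Implicit.
Unset Printing Implicit Defensive.

Import Order.TTheory GRing.Theory Num.Theory.
Import numFieldNormedType.Exports.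

Local Open Scope ring_scope.

(* Vectors of R^d are column vectors; observations are numbered from 0, so that
   the index set {1, ..., n} of the first n observations becomes 'I_n. *)

Definition spd (R : realType) (d : nat) (A : 'M[R]_d) : Prop :=
  A^T = A /\ forall v : 'cV[R]_d, v != 0 -> 0 < (v^T *m A *m v) 0 0.

(* For A symmetric positive definite, the set below is a singleton; the default
   value 0 is only reached outside that case. *)
Definition spd_sqrt (R : realType) (d : nat) (A : 'M[R]_d) : 'M[R]_d :=
  xget 0 [set B : 'M[R]_d | spd B /\ B *m B = A]%classic.

(* The library norm on matrices is the maximum norm, not the Euclidean one. *)
Definition enorm (R : realType) (d : nat) (v : 'cV[R]_d) : R :=
  Num.sqrt (\sum_(k < d) v k 0 ^+ 2).

Definition Rinf (R : realType) (d : nat) (Sigma : 'M[R]_d) : 'M[R]_d :=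
  spd_sqrt (invmx Sigma).

Definition Rm (R : realType) (d : nat) (T Sigma : 'M[R]_d) (m : nat) : 'M[R]_d :=
  spd_sqrt (invmx Sigma + m%:R^-1 *: invmx T).

Definition mean (R : realType) (d n : nat) (x : 'I_n -> 'cV[R]_d)
    (J : {set 'I_n}) : 'cV[R]_d :=
  (#|J|%:R)^-1 *: \sum_(j in J) x j.

Definition Q (R : realType) (d : nat) (alpha : R) (T Sigma : 'M[R]_d) (n : nat)
    (x : 'I_n -> 'cV[R]_d) (P : {set {set 'I_n}}) : R :=
  (alpha / Num.sqrt (\det T)) ^+ #|P| *
  (\prod_(J in P)
     ((factorial #|J|)%:R /
      (#|J|%:R `^ ((d%:R + 2) / 2) * \det (Rm T Sigma #|J|)))) *
  expR (2^-1 * \sum_(J in P)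
     #|J|%:R * enorm (invmx (Rm T Sigma #|J|) *m
                      (Rinf Sigma *m Rinf Sigma) *m mean x J) ^+ 2).

Definition is_MAP (R : realType) (d : nat) (alpha : R) (T Sigma : 'M[R]_d)
    (n : nat) (x : 'I_n -> 'cV[R]_d) (P : {set {set 'I_n}}) : Prop :=
  finset.partition P [set: 'I_n]%SET /\
  forall P' : {set {set 'I_n}}, finset.partition P' [set: 'I_n]%SET ->
    Q alpha T Sigma x P' <= Q alpha T Sigma x P.

Definition clusters_meeting_ball (R : realType) (d n : nat)
    (x : 'I_n -> 'cV[R]_d) (P : {set {set 'I_n}}) (r : R) : {set {set 'I_n}} :=
  [set J in P | [exists j in J, enorm (x j) < r]]%SET.

(* Main.v *)
Require Import Defs.
From mathcomp Require Import all_boot all_order all_algebra.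
From mathcomp Require Import all_classical all_reals all_analysis.
From mathcomp Require Import ring lra zify.
From mathcomp Require Import complex.
Import Order.TTheory GRing.Theory Num.Theory.
Import numFieldNormedType.Exports.
Local Open Scope ring_scope.

Set Implicit Arguments.
Unset Strict Implicit.
Unset Printing Implicit Defensive.

(** The theorem holds because a cluster of a MAP partition that meets the ball
    contains a fixed proportion [gamma] of all the observations
    ([cluster_linear]), and at most [1 / gamma] disjoint clusters can do so.

    Write [Lam] for the inverse of [Sigma] and [Pi] for the inverse of [T].
    Completing the square rewrites the posterior score as a product over the
    clusters J of a weight, which depends only on m = #|J| and is of order
    m! / m^((d + 2) / 2), times the exponential of the energy

      E(J) = max over th of  sum_(j in J) (<th, x_j> - <th, th> / 2)
                             - th^T Pi th / 2,

    where < , > is the inner product given by [Lam]. The maximum is attained at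
    the posterior mean of the cluster centre. Every estimate on the energy comes
    from plugging a well chosen th into this variational formula; the weights
    only need that det R_m stays between two positive constants.

    - Some cluster K is large ([largest_cluster]). The MAP partition beats the
      partition with a single cluster, whose score is at least c^n n!. By
      E(J) <= sum_(j in J) <x_j, x_j> / 2 and the bound on the mean of the
      squared norms, a partition with clusters of size at most N scores at most
      (c' N)^n. Since n! >= (n / e)^n, N is at least [delta * n].
    - The posterior mean of K is bounded: #|K| <th, th> <= 2 E(K) = O(n), while
      #|K| >= [delta * n].
    - Let J be another cluster and x_j a point of J in the ball. Moving j from J
      to K changes the energies by a bounded amount from below, because x_j and
      the posterior mean of K are bounded ([energy_remove], [energy_add]), while
      the weights gain a factor of order #|K| / #|J| ([weight_exchange]). By
      maximality #|J| is at least a constant times #|K|, hence of order n.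

    The square roots R_m are only specified by a choice among the positive
    definite solutions of B * B = A, so the existence of such a B has to be
    proved: it is a real polynomial in A, by the spectral theorem. *)

(** * The spectrum of a real symmetric matrix *)

Lemma interpolation (F : fieldType) (f : F -> F) (s : seq F) :
  exists p : {poly F}, forall a, a \in s -> p.[a] = f a.
Proof.
elim: s => [|b s [p hp]]; first by exists 0.
have [bs|bs] := boolP (b \in s).
  by exists p => a; rewrite inE => /predU1P[->|]; exact: hp.
pose q := \prod_(c <- s) ('X - c%:P).
have qb : q.[b] != 0 by rewrite -rootE root_prod_XsubC.
exists (p + (f b - p.[b]) / q.[b] *: q) => a.
rewrite inE hornerD hornerZ => /predU1P[->|as_].
  by rewrite divfK// addrC subrK.
have /rootP -> : root q a by rewrite root_prod_XsubC.
by rewrite mulr0 addr0 hp.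
Qed.

(** Over R[i] the matrix is unitarily diagonalisable with real eigenvalues; both
    assertions then descend to R, so that a polynomial in A is determined by its
    values on a finite list of real eigenvalues. *)
Lemma symmetric_spectrum (R : rcfType) (d : nat) (A : 'M[R]_d.+1) : A^T = A ->
  exists2 s : seq R, all (eigenvalue A) s &
    forall p : {poly R}, all (root p) s -> horner_mx A p = 0.
Proof.
move=> symA; pose f := (real_complex R : {rmorphism R -> R[i]}).
pose AC := map_mx f A.
have hermA : AC \is hermitianmx d.+1 false Num.conj.
  apply: realsym_hermsym.
    apply/is_hermitianmxP.
    by rewrite expr0 scale1r map_mx_id// /AC map_trmx symA.
  apply/mxOverP => i j; rewrite mxE; apply/complex_realP; by exists (A i j).
have normA := hermitian_normalmx hermA.
have /orthomx_spectralP specA := normA.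
have real_diag := hermitian_spectral_diag_real hermA.
set P := spectralmx AC in specA; set D := spectral_diag AC in specA real_diag.
have unitP : P \in unitmx := spectral_unit AC.
pose lam j := complex.Re (D 0 j).
have DE j : D 0 j = f (lam j) by rewrite /f /= RRe_real //; exact/mxOverP.
exists [seq lam j | j : 'I_d.+1].
  apply/allP => _ /mapP[j _ ->].
  rewrite -(eigenvalue_map f); apply/eigenvalueP; exists (row j P).
    rewrite -/AC specA -row_mul !mulmxA mulmxV// mul1mx mul_diag_mx.
    by apply/rowP => k; rewrite !mxE DE.
  apply/eqP => /(congr1 (mulmx^~ (invmx P))); rewrite -row_mul mulmxV// mul0mx.
  by move=> /rowP/(_ j)/eqP; rewrite !mxE eqxx oner_eq0.
move=> p /allP rootp; apply: (map_mx_inj (f := f)).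
rewrite map_mx0 map_horner_mx -/AC specA horner_mx_uconjC// horner_mx_diag.
suff -> : map_mx (horner (map_poly f p)) D = 0 by rewrite raddf0 mulmx0 mul0mx.
apply/rowP => j; rewrite !mxE DE horner_map.
have /rootP -> : root p (lam j) by apply: rootp; rewrite map_f// mem_enum.
by rewrite rmorph0.
Qed.

(** * Positive definite matrices and their square roots *)

Definition bform (R : realType) (d : nat) (M : 'M[R]_d) (u v : 'cV[R]_d) : R :=
  (u^T *m M *m v) 0 0.

Section BilinearForms.
Context {R : realType} {d : nat}.
Implicit Types (A B M : 'M[R]_d) (u v w : 'cV[R]_d) (a : R).

Lemma bformDl M u v w : bform M (u + v) w = bform M u w + bform M v w.
Proof. by rewrite /bform linearD/= !mulmxDl mxE. Qed.

Lemma bformDr M u v w : bform M u (v + w) = bform M u v + bform M u w.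
Proof. by rewrite /bform mulmxDr mxE. Qed.

Lemma bformNl M u v : bform M (- u) v = - bform M u v.
Proof. by rewrite /bform linearN/= !mulNmx mxE. Qed.

Lemma bformNr M u v : bform M u (- v) = - bform M u v.
Proof. by rewrite /bform mulmxN mxE. Qed.

Lemma bformDmx A B u v : bform (A + B) u v = bform A u v + bform B u v.
Proof. by rewrite /bform mulmxDr mulmxDl mxE. Qed.

Lemma bformZmx a A u v : bform (a *: A) u v = a * bform A u v.
Proof. by rewrite /bform -scalemxAr -scalemxAl mxE. Qed.

Lemma bformZl a M u v : bform M (a *: u) v = a * bform M u v.
Proof. by rewrite /bform linearZ/= -!scalemxAl mxE. Qed.

Lemma bformZr a M u v : bform M u (a *: v) = a * bform M u v.
Proof. by rewrite /bform -scalemxAr mxE. Qed.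

Lemma bform_sumr (I : finType) (P : pred I) (F : I -> 'cV[R]_d) M u :
  bform M u (\sum_(i | P i) F i) = \sum_(i | P i) bform M u (F i).
Proof. by rewrite /bform mulmx_sumr summxE. Qed.

Lemma bformC M u v : M^T = M -> bform M u v = bform M v u.
Proof.
move=> symM; rewrite /bform -[LHS](mxE trmx_key (fun i j => _ j i)) -/(trmx _).
by rewrite !trmx_mul trmxK symM mulmxA.
Qed.

Lemma enorm_sqr v : enorm v ^+ 2 = bform 1%:M v v.
Proof.
rewrite /enorm sqr_sqrtr ?sumr_ge0// => [|k _]; last exact: sqr_ge0.
rewrite /bform mulmx1 mxE; apply: eq_bigr => k _.
by rewrite mxE expr2.
Qed.

Lemma enorm_gt0 v : (0 < enorm v) = (v != 0).
Proof.
apply/idP/idP => [|v0].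
  apply: contraTneq => ->; rewrite -leNgt /enorm big1 ?sqrtr0// => k _.
  by rewrite mxE expr0n.
have [k vk0] : exists k, v k 0 != 0 by exact/cV0Pn.
rewrite sqrtr_gt0 (bigD1 k)//= ltr_pwDl// ?sumr_ge0// => [|i _];
  last exact: sqr_ge0.
by rewrite lt_def sqrf_eq0 vk0 sqr_ge0.
Qed.

(** Any constant above the sum of the absolute values of the entries works; the
    summand 1 makes it positive. *)
Lemma bform_le_enorm M : exists2 c : R, 0 < c &
  forall v, bform M v v <= c * enorm v ^+ 2.
Proof.
exists (1 + \sum_i \sum_j `|M i j|) => [|v].
  by rewrite ltr_pwDl// sumr_ge0// => i _; rewrite sumr_ge0.
have coord i : `|v i 0| <= enorm v.
  rewrite /enorm -sqrtr_sqr ler_wsqrtr// (bigD1 i)//= lerDl sumr_ge0// => k _.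
  exact: sqr_ge0.
rewrite mulrDl mul1r (@le_trans _ _ (\sum_i \sum_j `|M i j| * enorm v ^+ 2))//.
  rewrite /bform -mulmxA mxE; apply: ler_sum => i _.
  rewrite !mxE mulr_sumr; apply: ler_sum => j _.
  rewrite mulrCA (le_trans (ler_norm _))// normrM ler_wpM2l// normrM expr2.
  by rewrite ler_pM.
rewrite mulr_suml -[leLHS]add0r lerD ?sqr_ge0//.
by apply: ler_sum => i _; rewrite mulr_suml.
Qed.

Lemma spd_ge0 A v : spd A -> 0 <= bform A v v.
Proof.
move=> [_ posA]; have [->|v0] := eqVneq v 0; last exact/ltW/posA.
by rewrite /bform mulmx0 mxE.
Qed.

Lemma spd_unitmx A : spd A -> A \in unitmx.
Proof.
move=> [symA posA]; rewrite unitmxE unitfE; apply/negP => /det0P[v v0 vA].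
have := posA v^T; rewrite trmx_eq0 v0 => /(_ isT).
by rewrite trmxK vA mul0mx mxE ltxx.
Qed.

Lemma spd_invmx A : spd A -> spd (invmx A).
Proof.
move=> spdA; have unitA := spd_unitmx spdA; case: (spdA) => symA posA.
split=> [|v v0]; first by rewrite trmx_inv symA.
have := posA (invmx A *m v).
have -> : invmx A *m v != 0.
  apply: contra v0 => /eqP/(congr1 (mulmx A)).
  by rewrite mulKVmx// mulmx0 => ->.
by rewrite trmx_mul trmx_inv symA -!mulmxA mulKVmx//; exact.
Qed.

Lemma spdD A B : spd A -> spd B -> spd (A + B).
Proof.
move=> [symA posA] [symB posB]; split=> [|v v0].
  by rewrite linearD/= symA symB.
by rewrite mulmxDr mulmxDl mxE addr_gt0 ?posA ?posB.
Qed.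

Lemma spdZ a A : 0 < a -> spd A -> spd (a *: A).
Proof.
move=> a0 [symA posA]; split=> [|v v0]; first by rewrite linearZ/= symA.
by rewrite -scalemxAr -scalemxAl mxE mulr_gt0 ?posA.
Qed.

End BilinearForms.

Lemma horner_mx_symmetric (R : comNzRingType) (d : nat) (A : 'M[R]_d.+1)
  (p : {poly R}) : A^T = A -> (horner_mx A p)^T = horner_mx A p.
Proof.
move=> symA; elim/poly_ind: p => [|p c IH]; first by rewrite rmorph0 linear0.
rewrite rmorphD rmorphM/= horner_mx_X horner_mx_C linearD/= tr_scalar_mx.
by congr (_ + _); rewrite trmx_mul symA IH; exact: comm_mx_horner.
Qed.

(** Let H = p(A), where p interpolates the fourth root on the spectrum of A. Then
    H^4 = A, so H^2 is a square root of A; it is positive definite because H is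
    symmetric and invertible. *)
Lemma spd_sqrt_exists (R : realType) (d : nat) (A : 'M[R]_d) :
  spd A -> exists B : 'M[R]_d, spd B /\ B *m B = A.
Proof.
case: d A => [|d] A spdA.
  by exists A; split=> //; apply/matrixP => -[].
have [symA posA] := spdA; have [s eig_s zero_s] := symmetric_spectrum symA.
have [p hp] := interpolation (fun a => Num.sqrt (Num.sqrt a)) s.
pose H := horner_mx A p.
have s_ge0 a : a \in s -> 0 <= a.
  move=> /(allP eig_s)/eigenvalueP[v vA v0].
  have v'0 : v^T != 0 by rewrite trmx_eq0.
  have := posA _ v'0; rewrite trmxK vA -scalemxAl mxE => /ltW.
  suff /pmulr_lge0 -> : 0 < (v *m v^T) 0 0 by [].
  rewrite -{1}[v]trmxK -[X in X *m _]mulmx1.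
  by rewrite [_ 0 0](esym (enorm_sqr v^T)) exprn_gt0// enorm_gt0.
have H4 : H ^+ 4 = A.
  apply/eqP; rewrite -subr_eq0 -rmorphXn -[X in _ - X]horner_mx_X -rmorphB.
  apply/eqP/zero_s; apply/allP => a sa; apply/rootP.
  rewrite !hornerE hp//= -[4%N]/(2 * 2)%N exprM !sqr_sqrtr ?sqrtr_ge0 ?subrr//.
  exact: s_ge0.
have symH : H^T = H by exact: horner_mx_symmetric.
exists (H * H); split; last by rewrite -[RHS]H4 -expr2 -[LHS]expr2 -exprM.
split=> [|v v0]; first by rewrite trmx_mul symH.
have -> : (v^T *m (H * H) *m v) 0 0 = enorm (H *m v) ^+ 2.
  by rewrite enorm_sqr /bform mulmx1 trmx_mul symH !mulmxA.
rewrite exprn_gt0// enorm_gt0; apply: contra v0 => /eqP Hv0.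
have unitA := spd_unitmx spdA.
by rewrite -(mulKmx unitA v) -H4 exprSr -mulmxA Hv0 !mulmx0.
Qed.

Lemma spd_sqrtP (R : realType) (d : nat) (A : 'M[R]_d) : spd A ->
  spd (spd_sqrt A) /\ spd_sqrt A *m spd_sqrt A = A.
Proof.
move=> spdA; have [B hB] := spd_sqrt_exists spdA.
pose S := [set B : 'M[R]_d | spd B /\ B *m B = A]%classic.
by have := xgetPex 0 (ex_intro S B hB).
Qed.

Lemma spd_det_gt0 (R : realType) (d : nat) (A : 'M[R]_d) : spd A -> 0 < \det A.
Proof.
move=> spdA; have [spdB <-] := spd_sqrtP spdA.
rewrite det_mulmx -expr2 lt_def sqr_ge0 andbT sqrf_eq0 -unitfE -unitmxE.
exact: spd_unitmx.
Qed.

(** The determinant is a polynomial in t without zero on the compact interval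
    [0, 1]. With t = 1 / m this bounds det R_m uniformly in m. *)
Lemma det_pencil_bounds (R : realType) (d : nat) (A B : 'M[R]_d) :
  spd A -> spd B -> exists2 b : R, 0 < b &
  forall t, 0 <= t <= 1 -> b <= \det (A + t *: B) <= b^-1.
Proof.
move=> spdA spdB.
pose p := \det (map_mx polyC A + 'X *: map_mx polyC B).
have pE t : p.[t] = \det (A + t *: B).
  rewrite /p -horner_evalE -det_map_mx map_mxD map_mxZ/= horner_evalE hornerX.
  congr (\det (_ + _ *: _)); apply/matrixP => i j;
    by rewrite !mxE horner_evalE hornerC.
have cont_p : {within `[0, 1], continuous (horner p)}%classic.
  by apply: continuous_subspaceT; exact: continuous_horner.
have [c0 c0i minp] := EVT_min ler01 cont_p.
have [c1 c1i maxp] := EVT_max ler01 cont_p.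
have pos t : t \in `[0, 1] -> 0 < p.[t].
  rewrite in_itv/= => /andP[t0 _]; rewrite pE; apply: spd_det_gt0.
  have [->|tn0] := eqVneq t 0; first by rewrite scale0r addr0.
  by apply: spdD => //; apply: spdZ => //; rewrite lt_def tn0.
exists (Num.min p.[c0] p.[c1]^-1) => [|t ht].
  by rewrite lt_min invr_gt0 !pos.
have ti : t \in `[0, 1] by rewrite in_itv.
rewrite -pE ge_min minp//= (le_trans (maxp _ ti))//.
rewrite -[leLHS]invrK lef_pV2 ?posrE ?invr_gt0 ?lt_min ?pos//=.
  by rewrite ge_min lexx orbT.
by rewrite invr_gt0 !pos.
Qed.

(** * The energy of a cluster *)

Section Energy.
Context {R : realType} {d : nat} (Lam Pi : 'M[R]_d).
Hypotheses (spdLam : spd Lam) (spdPi : spd Pi).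
Implicit Types (m : nat) (s y th : 'cV[R]_d).

(** [precision], [posterior_mean] and [energy] refer to a cluster of m points
    with sum s: the law of its centre given these points is Gaussian with inverse
    covariance [precision m] and mean [posterior_mean m s]. *)
Definition precision m : 'M[R]_d := m%:R *: Lam + Pi.

Definition posterior_mean m s : 'cV[R]_d := invmx (precision m) *m Lam *m s.

Definition energy m s : R := bform Lam (posterior_mean m s) s / 2.

Lemma precision_spd m : spd (precision m).
Proof.
case: m => [|m]; first by rewrite /precision scale0r add0r.
by apply: spdD => //; apply: spdZ => //; rewrite ltr0n.
Qed.

Lemma bform_precision m u v :
  bform (precision m) u v = m%:R * bform Lam u v + bform Pi u v.
Proof. by rewrite bformDmx bformZmx. Qed.

Lemma bform_posterior_mean m s th :
  bform (precision m) th (posterior_mean m s) = bform Lam th s.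
Proof.
rewrite /bform /posterior_mean -!mulmxA mulKVmx ?mulmxA//.
exact/spd_unitmx/precision_spd.
Qed.

(** The gap between the two sides is half the form of [precision m] at
    [th - posterior_mean m s]; [energy_posterior_mean] is the case of equality. *)
Lemma energy_ge m s th :
  bform Lam th s - bform (precision m) th th / 2 <= energy m s.
Proof.
have symA := proj1 (precision_spd m).
have := spd_ge0 (th - posterior_mean m s) (precision_spd m).
rewrite bformDl bformDr bformDr !bformNl !bformNr !bform_posterior_mean.
rewrite (bformC (posterior_mean m s) th symA) bform_posterior_mean /energy.
lra.
Qed.

Lemma energy_posterior_mean m s : energy m s =
  let c := posterior_mean m s in
  bform Lam c s - bform (precision m) c c / 2.
Proof. rewrite /= bform_posterior_mean /energy; lra. Qed.

Lemma energy_ge0 m s : 0 <= energy m s.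
Proof.
rewrite divr_ge0// -(bform_posterior_mean m) spd_ge0//; exact: precision_spd.
Qed.

Lemma energy0 : energy 0 0 = 0.
Proof. by rewrite /energy /bform mulmx0 mxE mul0r. Qed.

Lemma young_Lam th y : bform Lam th y <= bform Lam th th / 2 + bform Lam y y / 2.
Proof.
have := spd_ge0 (th - y) spdLam.
rewrite bformDl bformDr bformDr !bformNl !bformNr (bformC y th (proj1 spdLam)).
lra.
Qed.

(** The posterior mean of the larger cluster is used as a test vector for the
    smaller one. *)
Lemma energy_remove m s y :
  energy m.+1 (s + y) - bform Lam y y / 2 <= energy m s.
Proof.
apply: le_trans (energy_ge m s (posterior_mean m.+1 (s + y))).
rewrite energy_posterior_mean/= !bform_precision -[m.+1%:R]natr1 bformDr.
have := young_Lam (posterior_mean m.+1 (s + y)) y; lra.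
Qed.

(** The posterior mean of the smaller cluster is used as a test vector for the
    larger one. *)
Lemma energy_add m s y :
  energy m s - bform Lam (posterior_mean m s) (posterior_mean m s) -
    bform Lam y y / 2 <= energy m.+1 (s + y).
Proof.
apply: le_trans (energy_ge m.+1 (s + y) (posterior_mean m s)).
rewrite energy_posterior_mean/= !bform_precision -[m.+1%:R]natr1 bformDr.
have := young_Lam (- posterior_mean m s) y; rewrite !bformNl bformNr; lra.
Qed.

(** At the optimal th, Young's inequality bounds the contribution of each point to
    the variational formula separately, and the term of [Pi] is nonpositive. *)
Lemma energy_sum_le (I : finType) (J : {set I}) (x : I -> 'cV[R]_d) :
  energy #|J| (\sum_(j in J) x j) <= \sum_(j in J) bform Lam (x j) (x j) / 2.
Proof.
rewrite energy_posterior_mean/= bform_precision bform_sumr.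
set c := posterior_mean _ _.
have c0 := spd_ge0 c spdPi.
have : \sum_(j in J) bform Lam c (x j) <=
    \sum_(j in J) (bform Lam c c / 2 + bform Lam (x j) (x j) / 2).
  by apply: ler_sum => j _; exact: young_Lam.
rewrite big_split/= sumr_const -mulr_natl; lra.
Qed.

Lemma posterior_mean_le m s :
  m%:R * bform Lam (posterior_mean m s) (posterior_mean m s) <=
    2 * energy m s.
Proof.
have := bform_posterior_mean m s (posterior_mean m s).
rewrite bform_precision /energy => <-.
have := spd_ge0 (posterior_mean m s) spdPi; lra.
Qed.

(** The left-hand side is the exponent of a cluster in the score [Q], with
    [B] = R_m and [s] the sum of the points: m * B^2 is [precision m]. *)
Lemma enorm_energy m (B : 'M[R]_d) s : (0 < m)%N ->
  spd B -> B *m B = Lam + m%:R^-1 *: Pi ->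
  2^-1 * (m%:R * enorm (invmx B *m Lam *m (m%:R^-1 *: s)) ^+ 2) = energy m s.
Proof.
move=> m0 spdB BB; have m0' : m%:R != 0 :> R by rewrite pnatr_eq0 -lt0n.
have unitB := spd_unitmx spdB.
have precE : precision m = m%:R *: (B *m B).
  by rewrite BB scalerDr scalerA mulfV// scale1r.
rewrite mulrC /energy; congr (_ / 2).
have centerE :
    posterior_mean m s = m%:R^-1 *: (invmx B *m (invmx B *m (Lam *m s))).
  rewrite /posterior_mean -mulmxA; apply: (canLR (mulKmx _)).
    exact/spd_unitmx/precision_spd.
  rewrite precE -scalemxAl -scalemxAr scalerA mulfV// scale1r -mulmxA.
  by rewrite mulKVmx// mulKVmx.
rewrite -[_ *m Lam *m _]mulmxA -!scalemxAr centerE enorm_sqr !bformZl bformZr.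
rewrite mulVKf//; congr (_ * _).
by rewrite /bform mulmx1 [in RHS]trmx_mul trmx_inv (proj1 spdB) !mulmxA.
Qed.

End Energy.

(** * Moving a point between two blocks *)

(** Moving j from the block J to the block K. When J = {j} the block J \ {j}
    disappears, and [F set0 = 1] lets one product formula cover both cases; it
    is written without division because F takes values in a semiring. *)
Lemma partition_move (T : finType) (P : {set {set T}}) (D J K : {set T}) (j : T) :
  finset.partition P D -> J \in P -> K \in P -> J != K -> j \in J ->
  exists2 P', finset.partition P' D &
    forall (R : comPzSemiRingType) (F : {set T} -> R), F finset.set0 = 1 ->
      (\prod_(A in P') F A) * (F J * F K) =
      (\prod_(A in P) F A) * (F (J :\ j)%SET * F (j |: K)%SET).
Proof.
move=> partP JP KP neqJK jJ.
have KPJ : K \in (P :\ J)%SET by rewrite !inE eq_sym neqJK.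
have partP0 := partitionD1 (partitionD1 partP JP) KPJ.
set P0 := ((P :\ J) :\ K)%SET in partP0; set D0 := ((D :\: J) :\: K)%SET in partP0.
have prodP (R : comPzSemiRingType) (F : {set T} -> R) :
    \prod_(A in P) F A = F J * (F K * \prod_(A in P0) F A).
  by rewrite (big_setD1 J)//= (big_setD1 K).
have [_ trivP _] := and3P partP.
have notin (Q : {set {set T}}) (E A : {set T}) a :
    finset.partition Q E -> a \in A -> a \notin E -> A \notin Q.
  move=> /and3P[/eqP <- _ _] aA; apply: contra => AQ.
  by apply/bigcupP; exists A.
have disJK : [disjoint J & K] by move/finset.trivIsetP: trivP; exact.
have jK : j \notin K by apply: contraTN jJ => jK; rewrite (disjointFl disJK).
have subJ : J \subset D.
  by move/and3P: partP => [/eqP <- _ _]; exact: finset.bigcup_sup.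
have subK : K \subset D.
  by move/and3P: partP => [/eqP <- _ _]; exact: finset.bigcup_sup.
have partP1 : finset.partition ((j |: K) |: P0)%SET ((j |: K) :|: D0)%SET.
  apply: partitionU1 => //; first by apply/set0Pn; exists j; rewrite !inE eqxx.
  rewrite -setI_eq0; apply/eqP/setP => i; rewrite !inE.
  case: (eqVneq i j) => [->|]; rewrite ?jJ ?andbF//=.
  by case: (i \in K); rewrite ?andbF.
have KP0 : (j |: K)%SET \notin P0.
  by apply: (notin _ _ _ j partP0); rewrite !inE ?eqxx// jJ andbF.
have [J0|Jn0] := eqVneq (J :\ j)%SET finset.set0.
  exists ((j |: K) |: P0)%SET.
    suff <- : ((j |: K) :|: D0)%SET = D by [].
    have Jj : J = [set j]%SET.
      apply/eqP; rewrite finset.eqEsubset finset.sub1set jJ andbT.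
      by rewrite -finset.setD_eq0 J0.
    apply/setP => i; rewrite !inE Jj inE; case: (eqVneq i j) => [->|_] /=.
      by rewrite (fintype.subsetP subJ).
    by case: (boolP (i \in K)) => //= iK; rewrite (fintype.subsetP subK).
  move=> R F F0; rewrite big_setU1//= prodP J0 F0 mul1r; ring.
have partP2 : finset.partition ((J :\ j) |: ((j |: K) |: P0))%SET
    ((J :\ j) :|: ((j |: K) :|: D0))%SET.
  apply: partitionU1 => //; rewrite -setI_eq0; apply/eqP/setP => i; rewrite !inE.
  case: (eqVneq i j) => //= _; case: (boolP (i \in J)) => //= iJ.
  by rewrite (disjointFr disJK iJ).
exists ((J :\ j) |: ((j |: K) |: P0))%SET.
  suff <- : ((J :\ j) :|: ((j |: K) :|: D0))%SET = D by [].
  apply/setP => i; rewrite !inE; case: (eqVneq i j) => [->|_] /=.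
    by rewrite (fintype.subsetP subJ).
  case: (boolP (i \in J)) => /= [iJ|_]; first by rewrite (fintype.subsetP subJ).
  by case: (boolP (i \in K)) => //= iK; rewrite (fintype.subsetP subK).
have /set0Pn[i iJj] := Jn0.
have JP1 : (J :\ j)%SET \notin ((j |: K) |: P0)%SET.
  apply: (notin _ _ _ i partP1) => //; move: iJj; rewrite !inE => /andP[ij iJ].
  by rewrite (negPf ij) (disjointFr disJK iJ) iJ.
by move=> R F F0; rewrite big_setU1//= big_setU1//= prodP; ring.
Qed.

(** * Factorials, and the weight of a cluster *)

Lemma expR1_fact (R : realType) (n : nat) : (n%:R / expR 1) ^+ n <= n`!%:R :> R.
Proof.
have e0 := expR_gt0 (1 : R).
rewrite expr_div_n ler_pdivrMr ?exprn_gt0//.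
elim: n => [|n IH]; first by rewrite !expr0 mulr1.
rewrite factS natrM !exprS -mulrA ler_wpM2l// mulrCA.
apply: le_trans (ler_wpM2l (ltW e0) IH).
case: n {IH} => [|n]; first by rewrite !expr0 mulr1 ltW// expR_gt1.
(* it remains to see that (1 + 1 / n) ^ n <= e *)
have n0 : n.+1%:R != 0 :> R by rewrite pnatr_eq0.
have -> : expR 1 = expR n.+1%:R^-1 ^+ n.+1 :> R.
  by rewrite -expRM_natl mulfV.
rewrite -exprMn lerXn2r ?nnegrE ?mulr_ge0 ?expR_ge0//.
apply: le_trans (ler_wpM2r _ (expR_ge1Dx _)) => //.
by rewrite mulrDl mul1r mulVf// natr1.
Qed.

Lemma fact_le_expn m N : (m <= N)%N -> (m`! <= N ^ m)%N.
Proof.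
elim: m => [|m IH] mN; first by rewrite expn_gt0 eqxx orbT.
by rewrite factS expnS leq_mul// IH// ltnW.
Qed.

Section Model.
Context {R : realType} {d : nat} (alpha : R) (T Sigma : 'M[R]_d).
Hypotheses (alpha_gt0 : 0 < alpha) (spdT : spd T) (spdSigma : spd Sigma).

Let Lam := invmx Sigma.
Let Pi := invmx T.
Let spdLam : spd Lam := spd_invmx spdSigma.
Let spdPi : spd Pi := spd_invmx spdT.
Let C : R := alpha / Num.sqrt (\det T).
Let a : R := (d%:R + 2) / 2.

(** The value 1 at m = 0 makes the empty set a neutral factor, as needed for
    [partition_move]. *)
Definition weight (m : nat) : R := if m == 0%N then 1 else
  alpha / Num.sqrt (\det T) *
  (m`!%:R / (m%:R `^ ((d%:R + 2) / 2) * \det (Rm T Sigma m))).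

Definition factor (n : nat) (x : 'I_n -> 'cV[R]_d) (J : {set 'I_n}) : R :=
  weight #|J| * expR (energy Lam Pi #|J| (\sum_(j in J) x j)).

Let C_gt0 : 0 < C.
Proof. by rewrite divr_gt0// sqrtr_gt0 spd_det_gt0. Qed.

Let a_ge0 : 0 <= a.
Proof. by rewrite divr_ge0// addr_ge0. Qed.

Lemma Rm_spd m : (0 < m)%N -> spd (Rm T Sigma m) /\
  Rm T Sigma m *m Rm T Sigma m = Lam + m%:R^-1 *: Pi.
Proof.
move=> m0; apply: spd_sqrtP; apply: spdD => //; apply: spdZ => //.
by rewrite invr_gt0 ltr0n.
Qed.

Lemma Q_factor n (x : 'I_n -> 'cV[R]_d) (P : {set {set 'I_n}}) :
  finset.set0 \notin P -> Q alpha T Sigma x P = \prod_(J in P) factor x J.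
Proof.
move=> P0; rewrite /Q mulr_sumr expR_sum -prodr_const -!big_split/=.
apply: eq_bigr => J JP; have J0 : (0 < #|J|)%N.
  by rewrite card_gt0; apply: contraNneq P0 => <-.
rewrite /factor /weight gtn_eqF//; congr (_ * expR _).
have [spdB BB] := Rm_spd J0; have [_ RR] := spd_sqrtP spdLam.
by rewrite /mean /Rinf RR (enorm_energy _ spdPi).
Qed.

Lemma factor0 n (x : 'I_n -> 'cV[R]_d) : factor x finset.set0 = 1.
Proof. by rewrite /factor cards0 big_set0 energy0 expR0 mulr1. Qed.

Lemma det_Rm_bounds : exists2 b : R, 0 < b &
  forall m, (0 < m)%N -> b <= \det (Rm T Sigma m) <= b^-1.
Proof.
have [b b0 hb] := det_pencil_bounds spdLam spdPi.
exists (Num.sqrt b) => [|m m0]; first by rewrite sqrtr_gt0.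
have [spdB BB] := Rm_spd m0; have detB := spd_det_gt0 spdB.
have -> : \det (Rm T Sigma m) = Num.sqrt (\det (Lam + m%:R^-1 *: Pi)).
  by rewrite -BB det_mulmx -expr2 sqrtr_sqr gtr0_norm.
have /andP[bD Db] : b <= \det (Lam + m%:R^-1 *: Pi) <= b^-1.
  by apply: hb; rewrite invr_ge0 ler0n invf_le1 ?ltr0n// ler1n.
by rewrite -sqrtrV ?(ltW b0)//; apply/andP; split; exact: ler_wsqrtr.
Qed.

Lemma weight_gt0 m : 0 < weight m.
Proof.
rewrite /weight; case: eqP => // /eqP; rewrite -lt0n => m0.
have [spdB _] := Rm_spd m0.
rewrite mulr_gt0// divr_gt0 ?ltr0n ?fact_gt0// mulr_gt0 ?powR_gt0 ?ltr0n//.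
exact: spd_det_gt0.
Qed.

Lemma factor_gt0 n (x : 'I_n -> 'cV[R]_d) J : 0 < factor x J.
Proof. by rewrite mulr_gt0 ?weight_gt0 ?expR_gt0. Qed.

Lemma weight_fact_le : exists2 c : R, 0 < c &
  forall m, (0 < m)%N -> weight m <= c * m`!%:R.
Proof.
have [b b0 hb] := det_Rm_bounds; exists (C / b) => [|m m0].
  by rewrite divr_gt0.
have /andP[bB _] := hb m m0.
rewrite /weight gtn_eqF// -[leRHS]mulrA ler_wpM2l ?(ltW C_gt0)// mulrC ler_wpM2r//.
rewrite lef_pV2 ?posrE ?mulr_gt0 ?powR_gt0 ?ltr0n//; last exact: lt_le_trans bB.
rewrite -[leLHS]mul1r ler_pM ?(ltW b0)//.
by rewrite -[leLHS](powRr0 m%:R) ler_powR// ler1n.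
Qed.

Lemma weight_fact_ge : exists2 c : R, 0 < c &
  forall n, (0 < n)%N -> c ^+ n * n`!%:R <= weight n.
Proof.
have [b b0 hb] := det_Rm_bounds.
pose c0 := Num.min 1 (C * b); have c00 : 0 < c0 by rewrite lt_min ltr01 mulr_gt0.
exists (c0 * expR (- a)) => [|n n0]; first by rewrite mulr_gt0 ?expR_gt0.
have /andP[bB Bb] := hb n n0; have B0 := lt_le_trans b0 bB.
have n0' : 0 < n%:R :> R by rewrite ltr0n.
rewrite /weight gtn_eqF// mulrCA mulrC; apply: ler_wpM2l => //.
have powle : n%:R `^ a <= expR (a * n%:R).
  rewrite /powR gt_eqF// ler_expR ler_wpM2l//.
  by apply: (le_trans (ltW (ln_sublinear _))).
have na0 : 0 < n%:R `^ a by rewrite powR_gt0.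
rewrite ler_pdivlMr ?mulr_gt0// exprMn -expRM_natl mulrN.
have c0C : c0 * b^-1 <= C by rewrite ler_pdivrMr// ge_min lexx orbT.
apply: le_trans c0C.
rewrite mulrA ler_pM// ?mulr_ge0 ?exprn_ge0 ?expR_ge0 ?(ltW na0) ?(ltW B0)
  ?(ltW c00)//.
rewrite -mulrA -[leRHS]mulr1.
rewrite ler_pM ?exprn_ge0 ?mulr_ge0 ?expR_ge0 ?(ltW na0) ?(ltW c00)//.
  by rewrite ler_iXnr ?(ltW c00)// ge_min lexx.
by rewrite mulrC expRN ler_pdivrMr ?expR_gt0// mul1r [_ * a]mulrC.
Qed.

(** Up to constants, weight (m + 1) / weight m is m + 1: the power of m + 1
    exceeds that of m by at most a factor 2^((d + 2) / 2), and the determinants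
    are comparable. [weight_pred_ge] is the converse bound, which includes
    m = 0. *)
Lemma weight_succ_ge : exists2 c : R, 0 < c &
  forall m, (0 < m)%N -> c * m.+1%:R * weight m <= weight m.+1.
Proof.
have [b b0 hb] := det_Rm_bounds; exists (2 `^ (- a) * b ^+ 2) => [|m m0].
  by rewrite mulr_gt0 ?powR_gt0 ?exprn_gt0.
have /andP[bB Bb] := hb m m0; have /andP[bB' Bb'] := hb m.+1 isT.
have B0 := lt_le_trans b0 bB; have B'0 := lt_le_trans b0 bB'.
have X0 : 0 < m%:R `^ a :> R by rewrite powR_gt0 ?ltr0n.
have Y0 : 0 < m.+1%:R `^ a :> R by rewrite powR_gt0 ?ltr0n.
have YX : 2 `^ (- a) * m.+1%:R `^ a <= m%:R `^ a.
  rewrite powRN mulrC ler_pdivrMr ?powR_gt0// -powRM//.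
  by rewrite ge0_ler_powR ?nnegrE ?mulr_ge0// -natrM ler_nat; lia.
have DD : b ^+ 2 * \det (Rm T Sigma m.+1) <= \det (Rm T Sigma m).
  apply: le_trans bB; rewrite expr2 -mulrA -[leRHS]mulr1 ler_wpM2l ?(ltW b0)//.
  by rewrite mulrC -ler_pdivlMr// div1r.
rewrite /weight /= (gtn_eqF m0) factS natrM.
set X := _ `^ _ in X0 YX *; set Y := _ `^ _ in Y0 YX *.
set D := \det _ in B0 DD *; set D' := \det _ in B'0 DD *.
have -> : 2 `^ (- a) * b ^+ 2 * m.+1%:R * (C * (m`!%:R / (X * D))) =
    C * (m.+1%:R * m`!%:R * (2 `^ (- a) * b ^+ 2 / (X * D))) by ring.
rewrite !ler_wpM2l ?(ltW C_gt0) ?mulr_ge0// ler_pdivrMr ?mulr_gt0//.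
rewrite [leRHS]mulrC ler_pdivlMr ?mulr_gt0//.
rewrite mulrACA ler_pM// mulr_ge0 ?powR_ge0 ?sqr_ge0 ?(ltW Y0) ?(ltW B'0)//.
Qed.

Lemma weight_pred_ge : exists2 c : R, 0 < c &
  forall m, c * weight m.+1 <= m.+1%:R * weight m.
Proof.
have [b b0 hb] := det_Rm_bounds; exists (Num.min (b ^+ 2) (b / C)) => [|m].
  by rewrite lt_min exprn_gt0// divr_gt0.
have /andP[bB' Bb'] := hb m.+1 isT; have B'0 := lt_le_trans b0 bB'.
have [m0|m0] := posnP m.
  rewrite m0 in bB' Bb' B'0 *.
  rewrite /weight /= powR1 !mul1r -/C.
  apply: (@le_trans _ _ (b / C * (C / \det (Rm T Sigma 1)))).
    rewrite ler_wpM2r ?(ltW (divr_gt0 _ _))//.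
    by rewrite ge_min lexx orbT.
  by rewrite mulrA divfK ?gt_eqF// ler_pdivrMr// mul1r.
have /andP[bB Bb] := hb m m0; have B0 := lt_le_trans b0 bB.
have X0 : 0 < m%:R `^ a :> R by rewrite powR_gt0 ?ltr0n.
have Y0 : 0 < m.+1%:R `^ a :> R by rewrite powR_gt0 ?ltr0n.
have XY : m%:R `^ a <= m.+1%:R `^ a :> R.
  by rewrite ge0_ler_powR ?nnegrE// ler_nat.
have DD : b ^+ 2 * \det (Rm T Sigma m) <= \det (Rm T Sigma m.+1).
  apply: le_trans bB'; rewrite expr2 -mulrA -[leRHS]mulr1 ler_wpM2l ?(ltW b0)//.
  by rewrite mulrC -ler_pdivlMr// div1r.
apply: (@le_trans _ _ (b ^+ 2 * weight m.+1)).
  by rewrite ler_wpM2r ?(ltW (weight_gt0 _))// ge_min lexx.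
rewrite /weight /= (gtn_eqF m0) factS natrM.
set X := _ `^ _ in X0 XY *; set Y := _ `^ _ in Y0 XY *.
set D := \det _ in B0 DD *; set D' := \det _ in B'0 DD *.
have -> : b ^+ 2 * (C * (m.+1%:R * m`!%:R / (Y * D'))) =
    m.+1%:R * (C * (m`!%:R * (b ^+ 2 / (Y * D')))) by ring.
rewrite !ler_wpM2l ?(ltW C_gt0)// ler_pdivrMr ?mulr_gt0//.
rewrite [leRHS]mulrC ler_pdivlMr ?mulr_gt0// mulrCA ler_pM ?(ltW X0)//.
by rewrite mulr_ge0 ?sqr_ge0 ?(ltW B0).
Qed.

(** The effect on the weights of moving a point from a cluster of size m + 1 to
    one of size k; here m = 0 is the case of a singleton. *)
Lemma weight_exchange : exists2 c : R, 0 < c &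
  forall m k, (0 < k)%N ->
    c * k.+1%:R * (weight m.+1 * weight k) <= m.+1%:R * (weight m * weight k.+1).
Proof.
have [c c0 hc] := weight_succ_ge; have [c' c'0 hc'] := weight_pred_ge.
exists (c' * c) => [|m k k0]; first exact: mulr_gt0.
have w0 i : 0 <= weight i := ltW (weight_gt0 i).
have -> : c' * c * k.+1%:R * (weight m.+1 * weight k) =
  (c' * weight m.+1) * (c * k.+1%:R * weight k) by ring.
rewrite [leRHS]mulrA; apply: ler_pM (hc' m) (hc k k0).
  by rewrite mulr_ge0// ltW.
by rewrite !mulr_ge0// ltW.
Qed.

(** * MAP partitions *)

Lemma trivial_partition n : (0 < n)%N ->
  finset.partition [set [set: 'I_n]]%SET [set: 'I_n]%SET.
Proof.
move=> n0; rewrite /finset.partition finset.cover1 eqxx finset.trivIset1.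
rewrite inE/= eq_sym.
by apply/set0Pn; exists (Ordinal n0); rewrite inE.
Qed.

(** Compares P with the partition into one cluster. The upper bound for the
    score of P is distributed over the points: each point of J contributes at
    most c1 * N * expR (<x_j, x_j> / 2), where N is the largest block size. *)
Lemma largest_cluster (L : R) : exists2 delta : R, 0 < delta &
  forall n (x : 'I_n -> 'cV[R]_d) (P : {set {set 'I_n}}), (0 < n)%N ->
    is_MAP alpha T Sigma x P -> \sum_i bform Lam (x i) (x i) <= L * n%:R ->
    exists2 K, K \in P & delta * n%:R <= #|K|%:R.
Proof.
have [c c0 hc] := weight_fact_le; have [c2 c20 hc2] := weight_fact_ge.
pose c1 := Num.max 1 c; have c1_ge1 : 1 <= c1 by rewrite le_max lexx.
have c1_gt0 : 0 < c1 := lt_le_trans ltr01 c1_ge1.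
exists (c2 / expR 1 / (c1 * expR (L / 2))) => [|n x P n0 [partP maxP] hL].
  by rewrite !divr_gt0 ?mulr_gt0 ?expR_gt0.
have /and3P[/eqP covP _ P0] := partP.
have K0P : finset.pblock P (Ordinal n0) \in P.
  by apply: finset.pblock_mem; rewrite covP inE.
have [K KP maxK] : exists2 K, K \in P & forall J, J \in P -> (#|J| <= #|K|)%N.
  case: (arg_maxnP (P := mem P) (fun J : {set 'I_n} => #|J|) K0P) => K.
  by exists K.
exists K => //; set N := #|K| in maxK *.
have factorle J : J \in P ->
    factor x J <= \prod_(j in J) (c1 * N%:R * expR (bform Lam (x j) (x j) / 2)).
  move=> JP; rewrite big_split/= prodr_const -expR_sum /factor.
  have J0 : (0 < #|J|)%N by rewrite card_gt0; apply: contraNneq P0 => <-.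
  rewrite ler_pM ?expR_ge0 ?(ltW (weight_gt0 _))//; last first.
    by rewrite ler_expR; exact: energy_sum_le.
  apply: le_trans (hc _ J0) _; rewrite exprMn ler_pM ?(ltW c0)//; last first.
    by rewrite -natrX ler_nat fact_le_expn//; exact: maxK.
  by apply: (@le_trans _ _ c1); rewrite ?le_max ?lexx ?orbT// ler_eXnr.
have := maxP _ (trivial_partition n0).
rewrite !Q_factor// ?inE; last by rewrite eq_sym; apply/set0Pn; exists (Ordinal n0).
rewrite big_set1 => leT.
have {}leT : weight n <= (c1 * N%:R * expR (L / 2)) ^+ n.
  apply: (@le_trans _ _ (factor x [set: 'I_n]%SET)).
    rewrite /factor cardsT card_ord ler_peMr ?(ltW (weight_gt0 _))//.
    by rewrite -expR0 ler_expR; exact: energy_ge0.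
  apply: le_trans leT _; apply: (@le_trans _ _ (\prod_(J in P) \prod_(j in J)
      (c1 * N%:R * expR (bform Lam (x j) (x j) / 2)))).
    by apply: ler_prod => J JP; rewrite ltW ?factor_gt0//= factorle.
  rewrite -(set_partition_big _ partP)/= big_split/= prodr_const cardsT card_ord.
  rewrite -expR_sum [in leRHS]exprMn -expRM_natl.
  rewrite ler_wpM2l ?exprn_ge0 ?mulr_ge0 ?(ltW c1_gt0)//.
  rewrite ler_expR -mulr_suml mulrA ler_pM2r// mulrC.
  by under eq_bigl do rewrite inE.
have : (c2 * (n%:R / expR 1)) ^+ n <= (c1 * N%:R * expR (L / 2)) ^+ n.
  apply: le_trans leT; apply: le_trans (hc2 _ n0); rewrite exprMn.
  by rewrite ler_wpM2l ?exprn_ge0 ?(ltW c20)// expR1_fact.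
rewrite ler_pXn2r ?nnegrE ?mulr_ge0 ?expR_ge0 ?invr_ge0 ?(ltW c20) ?(ltW c1_gt0)//.
move=> h; rewrite mulrAC ler_pdivrMr ?mulr_gt0 ?expR_gt0// mulrCA mulrA.
by apply: le_trans h; rewrite -mulrA (mulrC n%:R).
Qed.

(** Compares P with the partition obtained by moving j into the largest
    cluster. *)
Lemma cluster_linear (L rho : R) : exists2 gamma : R, 0 < gamma &
  forall n (x : 'I_n -> 'cV[R]_d) (P : {set {set 'I_n}}), (0 < n)%N ->
    is_MAP alpha T Sigma x P -> \sum_i bform Lam (x i) (x i) <= L * n%:R ->
    forall J j, J \in P -> j \in J -> bform Lam (x j) (x j) <= rho ->
      gamma * n%:R <= #|J|%:R.
Proof.
have [c c0 hc] := weight_exchange; have [delta de0 hde] := largest_cluster L.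
pose e := expR (- (rho + L / delta)); have e0 : 0 < e := expR_gt0 _.
exists (Num.min delta (c * delta * e)) => [|n x P n0 mapP hL J j JP jJ xj].
  by rewrite lt_min de0 !mulr_gt0.
have [K KP Kn] := hde _ _ _ n0 mapP hL; have [partP maxP] := mapP.
have [->|neqJK] := eqVneq J K.
  by apply: le_trans Kn; rewrite ler_wpM2r// ge_min lexx.
have /and3P[_ trivP P0] := partP.
have K0 : (0 < #|K|)%N by rewrite card_gt0; apply: contraNneq P0 => <-.
have jK : j \notin K.
  apply: contraTN jJ => jK; rewrite (disjointFl _ jK)//.
  by move/finset.trivIsetP: trivP; exact.
have cardJ : #|J| = #|(J :\ j)%SET|.+1 by rewrite (cardsD1 j J) jJ.
have cardK : #|(j |: K)%SET| = #|K|.+1 by rewrite cardsU1 jK.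
have [P' partP' prodP'] := partition_move partP JP KP neqJK jJ.
have P'0 : finset.set0 \notin P' by case/and3P: partP'.
have factors : factor x (J :\ j)%SET * factor x (j |: K)%SET <=
    factor x J * factor x K.
  have prod_gt0 (Q0 : {set {set 'I_n}}) : 0 < \prod_(A in Q0) factor x A.
    by apply: prodr_gt0 => A _; exact: factor_gt0.
  have := maxP _ partP'; rewrite !Q_factor// => leP.
  rewrite -(ler_pM2l (prod_gt0 P)) -prodP' ?factor0//.
  by rewrite ler_wpM2r// mulr_ge0 ?(ltW (factor_gt0 _ _)).
set m := #|(J :\ j)%SET| in cardJ; set k := #|K| in cardK K0 Kn.
set sJ := (\sum_(i in (J :\ j)%SET) x i); set sK := (\sum_(i in K) x i).
pose q := bform Lam (posterior_mean Lam Pi k sK) (posterior_mean Lam Pi k sK).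
(* the energies lose at most rho + L / delta by the move *)
have EJ : energy Lam Pi m.+1 (sJ + x j) - rho / 2 <= energy Lam Pi m sJ.
  have := energy_remove spdLam spdPi m sJ (x j); lra.
have EK : energy Lam Pi k sK - q - rho / 2 <= energy Lam Pi k.+1 (sK + x j).
  have := energy_add spdLam spdPi k sK (x j); rewrite -/q; lra.
(* the posterior mean of K is bounded since K is large *)
have q_le : q <= L / delta.
  have k0 : 0 < k%:R :> R by rewrite ltr0n.
  rewrite -(ler_pM2l k0) (le_trans (posterior_mean_le spdLam spdPi _ _))//.
  apply: (@le_trans _ _ (L * n%:R)).
    apply: le_trans hL; rewrite [leRHS](bigID (mem K))/= -[leLHS]addr0 lerD//.
      have := energy_sum_le spdLam spdPi K x; rewrite -/k -/sK -mulr_suml; lra.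
    by rewrite sumr_ge0// => i _; exact: spd_ge0.
  have L0 : 0 <= L.
    rewrite -(@pmulr_lge0 _ n%:R) ?ltr0n// (le_trans _ hL)// sumr_ge0// => i _.
    exact: spd_ge0.
  by rewrite mulrCA ler_wpM2l// ler_pdivlMr// mulrC.
have w0 : 0 < weight m * weight k.+1 := mulr_gt0 (weight_gt0 m) (weight_gt0 k.+1).
have step : weight m * weight k.+1 * e <= weight m.+1 * weight k.
  move: factors; rewrite /factor cardK cardJ -/m -/k -/sJ -/sK.
  have -> : \sum_(i in J) x i = sJ + x j by rewrite (big_setD1 j)//= addrC.
  have -> : \sum_(i in (j |: K)%SET) x i = sK + x j by rewrite big_setU1//= addrC.
  rewrite mulrACA -expRD mulrACA -expRD => h.
  set E := energy Lam Pi m.+1 (sJ + x j) + energy Lam Pi k sK in h.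
  rewrite -(ler_pM2r (expR_gt0 E)).
  apply: le_trans h; rewrite -[leLHS]mulrA ler_wpM2l ?(ltW w0)//.
  rewrite /e /E -expRD ler_expR; lra.
have ck0 : 0 <= c * k.+1%:R by rewrite mulr_ge0 ?(ltW c0).
have /le_trans/(_ (hc m k K0)) := ler_wpM2l ck0 step.
rewrite mulrCA mulrC ler_pM2r// cardJ; apply: le_trans.
apply: (@le_trans _ _ (c * delta * e * n%:R)).
  by rewrite ler_wpM2r// ge_min lexx orbT.
rewrite mulrAC ler_pM2r// -mulrA ler_pM2l//.
by apply: le_trans Kn _; rewrite ler_nat.
Qed.

(** The clusters in M are disjoint and each has at least gamma * n points. *)
Lemma few_clusters (L rho : R) : exists B : R,
  forall n (x : 'I_n -> 'cV[R]_d) (P M : {set {set 'I_n}}), (0 < n)%N ->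
    is_MAP alpha T Sigma x P -> \sum_i bform Lam (x i) (x i) <= L * n%:R ->
    M \subset P ->
    (forall J, J \in M -> exists2 j, j \in J & bform Lam (x j) (x j) <= rho) ->
    #|M|%:R <= B.
Proof.
have [gamma g0 hg] := cluster_linear L rho.
exists gamma^-1 => n x P M n0 mapP hL subMP hM.
have [partP _] := mapP; have n0' : 0 < n%:R :> R by rewrite ltr0n.
rewrite -[gamma^-1]mul1r ler_pdivlMr// -(ler_pM2r n0') mul1r -mulrA mulr_natl.
rewrite -sumr_const (@le_trans _ _ (\sum_(J in M) #|J|%:R))//.
  apply: ler_sum => J JM; have [j jJ xj] := hM J JM.
  by apply: hg mapP hL _ _ _ jJ xj => //; exact: (fintype.subsetP subMP).
have sumP : n = (\sum_(J in P) #|J|)%N.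
  by rewrite -(card_partition partP) cardsT card_ord.
rewrite -natr_sum ler_nat [leqRHS]sumP [leqRHS](finset.big_setID M)/=.
rewrite (finset.setIidPr subMP).
exact: leq_addr.
Qed.

End Model.

Lemma limn_esup_lty (R : realType) (u : nat -> R) (B : R) :
  (forall n, (0 < n)%N -> u n <= B) -> (limn_esup (fun n => (u n)%:E) < +oo)%E.
Proof.
move=> uB; apply: (@le_lt_trans _ _ B%:E); last exact: ltry.
pose V := [set n | (0 < n)%N]%classic.
apply: ereal_inf_le; exists (ereal_sup ((fun n => (u n)%:E) @` V)%classic).
  by exists V => //; exact: nbhs_infty_gt.
by apply: ge_ereal_sup => _ [n n0 <-]; rewrite lee_fin uB.
Qed.

Theorem corollary2p2 (R : realType) (d : nat) (hd : (0 < d)%N)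
    (alpha : R) (halpha : 0 < alpha)
    (T Sigma : 'M[R]_d) (hT : spd T) (hSigma : spd Sigma)
    (x : nat -> 'cV[R]_d)
    (hx : bounded_fun (fun n : nat =>
            (n.+1%:R : R)^-1 * \sum_(i < n.+1) enorm (x i) ^+ 2))
    (Jhat : forall n : nat, {set {set 'I_n}})
    (hJhat : forall n : nat, (0 < n)%N ->
       is_MAP alpha T Sigma (fun i : 'I_n => x i) (Jhat n))
    (r : R) (hr : 0 < r) :
  (limn_esup (fun n : nat =>
     (#|clusters_meeting_ball (fun i : 'I_n => x i) (Jhat n) r|%:R : R)%:E)
   < +oo)%E.
Proof.
have [lam lam0 hlam] := bform_le_enorm (invmx Sigma).
have [M hM] : exists M : R, forall n, (0 < n)%N ->
    \sum_(i < n) enorm (x i) ^+ 2 <= M * n%:R.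
  have [M [_ hM]] := hx; exists (M + 1) => -[//|n] _.
  have M1 : M < M + 1 by rewrite ltrDl.
  have /= h := hM _ M1 n I.
  have n0 : 0 < n.+1%:R :> R by rewrite ltr0n.
  by rewrite -ler_pdivrMr// mulrC (le_trans (ler_norm _)).
have [B hB] := few_clusters halpha hT hSigma (lam * M) (lam * r ^+ 2).
apply: (@limn_esup_lty _ _ B) => n n0.
apply: (hB n (fun i : 'I_n => x i) (Jhat n)) => //; first exact: hJhat.
- rewrite -mulrA (le_trans _ (ler_wpM2l (ltW lam0) (hM n n0)))// mulr_sumr.
  by apply: ler_sum => i _; exact: hlam.
- by apply/fintype.subsetP => J; rewrite inE => /andP[].
move=> J; rewrite inE => /andP[_ /existsP[j /andP[jJ xj]]]; exists j => //.
apply: le_trans (hlam _) _; rewrite ler_wpM2l ?(ltW lam0)//.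
by rewrite lerXn2r ?nnegrE ?sqrtr_ge0// ltW.
Qed.
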